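(* Let $y\in F(\mathcal D(F))$ and let $(y^\delta)_{\delta>0}$ be a family of noisy data satisfying $\mathcal S(y,y^\delta)\le\delta$ such that (with $y^0:=y$) for all $\delta\ge0$, and for two functionals $\mathcal R:X\to[0,\infty]$, $\mathcal S:Y\times Y\to[0,\infty]$, conditions (i)--(v), (A) and (B) of the context hold, with $x^\dagger$ an $\mathcal R$-minimizing solution of $F(x)=y$. Then we have $\mathcal T_X$-subsequential convergence as $\delta\to0$ to a solution of $F(x)=y$ for $x^\delta_{Mo}$ and for $x^\delta_\rho$ with $\rho$ according to rule I or rule II. If additionally condition (vi) of the context holds, then the same holds true for $x^\delta_\rho$ with $\rho$ according to rule III.
   Context: Setting: $(X,\mathcal T_X)$, $(Y,\mathcal T_Y)$ are topological spaces and $F:\mathcal D(F)\subseteq X\to Y$. An $\mathcal R$-minimizing solution of $F(x)=y$ is an element of $\mathcal D(F)$ minimizing $\mathcal R$ among all solutions of $F(x)=y$. For $\rho\ge0$ put $X^{ad}(\rho)=\{x\in\mathcal D(F):\mathcal R(x)\le\rho\}$. $\mathcal T_X$-subsequential convergence of a family $(\hat x^\delta)_{\delta>0}$ to a solution of $F(x)=y$ means: for any zero sequence $(\delta_n)_{n\in\mathbb N}$ (positive, $\delta_n\to0$) the sequence $\hat x^{\delta_n}$ has a $\mathcal T_X$-convergent subsequence whose limit solves $F(x)=y$. Morozov problem: minimize $\mathcal R(x)$ over $x\in\mathcal D(F)$ subject to $\mathcal S(F(x),y^\delta)\le\tau\delta$; a minimizer is denoted $x^\delta_{Mo}$. Ivanov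 problem with radius $\rho\ge0$: minimize $\mathcal S(F(x),y^\delta)$ over $x\in X^{ad}(\rho)$; a minimizer is denoted $x^\delta_\rho$. Choices of the radius. Rule I: $\rho_*^I=\mathcal R(x^\dagger)$. Rule II: $\rho_*^{II}$ is the minimum of the set of all $\rho\ge0$ such that a minimizer $x^\delta_\rho$ of the Ivanov problem exists and $\mathcal S(F(x^\delta_\rho),y^\delta)\le\tau\delta$. Rule III: $\rho_*^{III}$ is a $\rho$ such that a minimizer $x^\delta_\rho$ of the Ivanov problem exists and $\delta<\mathcal S(F(x^\delta_\rho),y^\delta)\le\tau\delta$. In all of these $\tau\ge1$ is a fixed constant independent of $\delta$. Conditions: (i) $F$ is $\mathcal T_X$-$\mathcal T_Y$-sequentially closed: if $(x_n)_{n\in\mathbb N}\subseteq\mathcal D(F)$, $x_n\to x$ in $\mathcal T_X$ and $F(x_n)\to z$ in $\mathcal T_Y$, then $x\in\mathcal D(F)$ and $F(x)=z$. (ii) $\mathcal R$ and $\mathcal S(\cdot,y^\delta)$ are lower semicontinuous with respect to $\mathcal T_X$ and $\mathcal T_Y$, respectively. (iii) For any $C>0$ the sublevel set $\{x\in\mathcal D(F):\mathcal R(x)\le C\}$ is $\mathcal T_X$-compact. (iv) For any $C>0$ and any $y^\delta\in Y$ the sublevel set $\{z\in F(\mathcal D(F)):\mathcal S(z,y^\delta)\le C\}$ is $\mathcal T_Y$-compact. (v) There exists a solution $x^\dagger$ of $F(x)=y$ with $\mathcal R(x^\dagger)<\infty$. (vi) There exists $\rho_0\ge0$ such that a minimizer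 $x^\delta_{\rho_0}$ of the Ivanov problem with radius $\rho_0$ exists and $\delta<\mathcal S(F(x^\delta_{\rho_0}),y^\delta)$. If $\rho_0<\rho_*^{II}$, then additionally: (a) for all $\rho\in(\rho_0,\rho_*^{II}]$ and all zero sequences $(d_n)_{n\in\mathbb N}$ (i.e. real sequences with $d_n\to0$) there exists a sequence of mappings $\varphi_n:X^{ad}(\rho)\to X^{ad}(\rho+d_n)$, $n\in\mathbb N$, such that $\mathcal S(F(\varphi_n(x)),y^\delta)\to\mathcal S(F(x),y^\delta)$ as $n\to\infty$ for all $x\in X^{ad}(\rho)$; (b) for all $\rho\in(\rho_0,\rho_*^{II}]$ at most one minimizer $x^\delta_\rho$ of the Ivanov problem exists. (A) For any two sequences $(y_n)_{n\in\mathbb N}$, $(\tilde y_n)_{n\in\mathbb N}$ in $Y$: if $\mathcal S(y_n,\tilde y_n)\to0$ and $\mathcal S(\tilde y_n,y)\to0$ as $n\to\infty$, then $\mathcal S(y_n,y)\to0$ as $n\to\infty$. (B) $\mathcal S(\tilde y,y)=0$ implies $\tilde y=y$.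
   Formalization: The formal theorem additionally assumes S(y^δ,y)→0 as δ→0 (automatic when S is symmetric) and reads ''compact'' in (iii) and (iv) as sequentially compact; without either change the claim has counterexamples. *)

(* Defs.v *)
From HB Require Import structures.
From mathcomp Require Import all_boot all_order all_algebra.
From mathcomp Require Import all_classical all_reals all_analysis.

Set Implicit Arguments.
Unset Strict Implicit.
Unset Printing Implicit Defensive.

Import Order.TTheory GRing.Theory Num.Theory.
Import numFieldNormedType.Exports.

Local Open Scope classical_set_scope.
Local Open Scope ring_scope.

(* The partial map F : D(F) -> Y is a total [F : X -> Y] together with its
   domain [D : set X]; values outside [D] are never used. Extended real valued
   functionals take values in [\bar K] for a real type [K]; [Rf] is the
   regularization functional and [w] is the (noisy) datum y^delta. *)

Definition has_cvg_subseq (T : topologicalType) (u : nat -> T) (l : T) : Prop :=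
  exists2 f : nat -> nat, increasing_seq f & (u \o f) @ \oo --> l.

(* Compactness is sequential: every convergence notion of the setting is, and
   covering compactness alone yields no convergent subsequences in a general
   topological space. *)
Definition seq_compact (T : topologicalType) (A : set T) : Prop :=
  forall u : nat -> T, (forall n, A (u n)) ->
    exists2 l, A l & has_cvg_subseq u l.

Definition seq_closed_map (X Y : topologicalType) (D : set X) (F : X -> Y) :
    Prop :=
  forall (u : nat -> X) (x : X) (z : Y), (forall n, D (u n)) ->
    u @ \oo --> x -> (F \o u) @ \oo --> z -> D x /\ F x = z.

Definition solutions (X Y : Type) (D : set X) (F : X -> Y) (y : Y) : set X :=
  [set x | D x /\ F x = y].

Definition minimizers (K : realType) (T : Type) (A : set T) (J : T -> \bar K) :
    set T :=
  [set x | A x /\ forall x', A x' -> (J x <= J x')%E].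

Definition Rminimizing_solutions (K : realType) (X Y : Type) (D : set X)
    (F : X -> Y) (Rf : X -> \bar K) (y : Y) : set X :=
  minimizers (solutions D F y) Rf.

Definition Xad (K : realType) (X : Type) (D : set X) (Rf : X -> \bar K)
    (rho : K) : set X :=
  [set x | D x /\ (Rf x <= rho%:E)%E].

Definition morozov_minimizers (K : realType) (X Y : Type) (D : set X)
    (F : X -> Y) (Rf : X -> \bar K) (S : Y -> Y -> \bar K)
    (tau delta : K) (w : Y) : set X :=
  minimizers [set x | D x /\ (S (F x) w <= (tau * delta)%:E)%E] Rf.

Definition ivanov_minimizers (K : realType) (X Y : Type) (D : set X)
    (F : X -> Y) (Rf : X -> \bar K) (S : Y -> Y -> \bar K)
    (rho : K) (w : Y) : set X :=
  minimizers (Xad D Rf rho) (fun x => S (F x) w).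

Definition ruleI (K : realType) (X : Type) (Rf : X -> \bar K) (xdag : X)
    (rho : K) : Prop :=
  rho%:E = Rf xdag.

Definition ruleII (K : realType) (X Y : Type) (D : set X)
    (F : X -> Y) (Rf : X -> \bar K) (S : Y -> Y -> \bar K)
    (tau delta : K) (w : Y) (rho : K) : Prop :=
  let admissible := [set r : K | 0 <= r /\
    exists2 x, ivanov_minimizers D F Rf S r w x &
      (S (F x) w <= (tau * delta)%:E)%E] in
  admissible rho /\ lbound admissible rho.

Definition ruleIII (K : realType) (X Y : Type) (D : set X)
    (F : X -> Y) (Rf : X -> \bar K) (S : Y -> Y -> \bar K)
    (tau delta : K) (w : Y) (rho : K) : Prop :=
  0 <= rho /\
  exists2 x, ivanov_minimizers D F Rf S rho w x &
    (delta%:E < S (F x) w /\ S (F x) w <= (tau * delta)%:E)%E.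

(* The radii rho + d_n are required to be nonnegative, since the sets X^ad(r)
   are only considered for r >= 0. *)
Definition ivanov_continuity (K : realType) (X Y : Type) (D : set X)
    (F : X -> Y) (Rf : X -> \bar K) (S : Y -> Y -> \bar K)
    (w : Y) (rho : K) : Prop :=
  forall d : nat -> K, d @ \oo --> (0 : K) -> (forall n, 0 <= rho + d n) ->
    exists2 phi : nat -> X -> X,
      (forall n x, Xad D Rf rho x -> Xad D Rf (rho + d n) (phi n x)) &
      (forall x, Xad D Rf rho x ->
        (fun n => S (F (phi n x)) w) @ \oo --> S (F x) w).

Definition condition_vi (K : realType) (X Y : Type) (D : set X)
    (F : X -> Y) (Rf : X -> \bar K) (S : Y -> Y -> \bar K)
    (tau delta : K) (w : Y) : Prop :=
  exists rho0 : K,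
    [/\ 0 <= rho0,
        (exists2 x, ivanov_minimizers D F Rf S rho0 w x &
           (delta%:E < S (F x) w)%E) &
        forall rhoII, ruleII D F Rf S tau delta w rhoII -> rho0 < rhoII ->
          forall rho, rho0 < rho -> rho <= rhoII ->
            ivanov_continuity D F Rf S w rho /\
            (forall x x', ivanov_minimizers D F Rf S rho w x ->
               ivanov_minimizers D F Rf S rho w x' -> x = x')].

(* The family is indexed by all of [K]; only indices delta > 0 matter. *)
Definition subseq_cvg_to_solution (K : realType) (X : topologicalType)
    (Y : Type) (D : set X) (F : X -> Y) (y : Y) (xh : K -> X) : Prop :=
  forall d : nat -> K, (forall n, 0 < d n) -> d @ \oo --> (0 : K) ->
    exists2 x, solutions D F y x & has_cvg_subseq (xh \o d) x.

(* Main.v *)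
Require Import Defs.
From mathcomp Require Import all_boot all_order all_algebra.
From mathcomp Require Import all_classical all_reals all_analysis.

Set Implicit Arguments.
Unset Strict Implicit.
Unset Printing Implicit Defensive.

Import Order.TTheory GRing.Theory Num.Theory.
Import numFieldNormedType.Exports.

Local Open Scope classical_set_scope.
Local Open Scope ring_scope.

(** All four regularization methods produce points [xh delta] with the same two
properties: [Rf (xh delta)] is at most r := [Rf xdag], and the residual
[S (F (xh delta)) (yd delta)] is at most [tau * delta]. These two bounds alone
force subsequential convergence to a solution ([subseq_cvg_of_bounds]). Indeed,
along a zero sequence the residual tends to 0, and the data tend to [y], so
condition (A) gives [S (F (xh delta)) y] tending to 0. Compactness of the
sublevel sets of [Rf] and of [S ^~ y] yields one subsequence along which both
[xh] and [F \o xh] converge, and the closedness of [F] identifies the limit of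
the images as the image [F l] of the limit [l]. Lower semicontinuity of [S ^~ y]
gives [S (F l) y = 0], hence [F l = y] by (B).

The two bounds come from comparing with [xdag], whose residual
[S y (yd delta)] is at most [delta], hence at most [tau * delta]:
- a Morozov minimizer competes with the feasible point [xdag];
- for rule I, [xdag] lies in the set over which the residual is minimized;
- for rule II, the radius r is itself admissible, so the least admissible
  radius is at most r. This requires the Ivanov problem of radius r to have a
  minimizer ([ivanov_minimizer_exists], by the direct method);
- for rule III, a radius at least r would make [xdag] a competitor and push the
  minimal residual down to [delta], against the strict lower bound of the rule;
  so the radius is below r. *)

(** * Sequences and lower semicontinuity *)

Lemma increasing_seq_cvgny (f : nat -> nat) :
  increasing_seq f -> f @ \oo --> \oo.
Proof.
move=> fincr P [N _ PN]; exists N => // m /= Nm.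
have infl k : (k <= f k)%N.
  elim: k => [//|k kf]; apply: leq_ltn_trans kf _.
  by have := leW_mono fincr k k.+1; rewrite !ltEnat /= => ->.
exact/PN/(leq_trans Nm)/infl.
Qed.

Lemma lower_semicontinuous_le (K : realType) (T : topologicalType)
    (f : T -> \bar K) (u : nat -> T) (l : T) (c : K) :
  lower_semicontinuous f -> u @ \oo --> l ->
  (\forall n \near \oo, (f (u n) <= c%:E)%E) -> (f l <= c%:E)%E.
Proof.
move=> lscf ul uc; rewrite leNgt; apply/negP => /lscf[V Vl cV].
have uV : \forall n \near \oo, V (u n) := ul _ Vl.
have [n [Vn]] := filter_ex (filterI uV uc).
by rewrite leNgt => /negP; apply; exact: cV.
Qed.

Lemma lower_semicontinuous_le_eps (K : realType) (T : topologicalType)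
    (f : T -> \bar K) (u : nat -> T) (l : T) (c : K) :
  lower_semicontinuous f -> u @ \oo --> l ->
  (forall e : K, 0 < e -> \forall n \near \oo, (f (u n) <= (c + e)%:E)%E) ->
  (f l <= c%:E)%E.
Proof.
move=> lscf ul uc; apply/lee_addgt0Pr => e e0.
by rewrite -EFinD; apply: (lower_semicontinuous_le lscf ul); exact: uc.
Qed.

Lemma cvge0_le (K : realType) (u : nat -> \bar K) (e : K) :
  u @ \oo --> (0%E : \bar K) -> 0 < e -> \forall n \near \oo, (u n <= e%:E)%E.
Proof.
move=> u0 e0; have : nbhs (0%E : \bar K) [set z | (z < e%:E)%E].
  by apply: open_nbhs_nbhs; split => /=; [exact: open_ereal_lt_ereal | rewrite lte_fin].
move=> /u0 une; have {}une : \forall n \near \oo, (u n < e%:E)%E := une.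
by apply: filterS une => n /ltW.
Qed.

(** * Compactness for the partial map F *)

(** Extracting first for [u] and then for its image turns two separate sequential
compactness properties into a joint one; closedness of the graph is what makes
the second limit the image of the first. *)
Lemma closed_map_cvg_subseq (X Y : topologicalType) (D A : set X) (B : set Y)
    (F : X -> Y) (u : nat -> X) :
  seq_closed_map D F -> A `<=` D -> seq_compact A -> seq_compact B ->
  (forall n, A (u n)) -> (\forall n \near \oo, B (F (u n))) ->
  exists2 l, A l & exists2 f, increasing_seq f &
    (u \o f) @ \oo --> l /\ (F \o u \o f) @ \oo --> F l.
Proof.
move=> clF AD cA cB uA uB.
have [l Al [f fincr ufl]] := cA u uA.
(* Only a tail of the image lies in B, so the second extraction is applied to
   the sequence shifted by N. *)
have [N _ NB] : \forall n \near \oo, B (F (u (f n))).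
  exact: (increasing_seq_cvgny fincr uB).
have [|z _ [g gincr vgz]] := cB (fun n => F (u (f (n + N)%N))).
  by move=> n; apply: NB; rewrite /= leq_addl.
have uhl : (fun n => u (f (g n + N)%N)) @ \oo --> l.
  have gy : (fun n => (g n + N)%N) @ \oo --> \oo.
    exact: cvg_comp (increasing_seq_cvgny gincr) (cvg_addnr N).
  exact: cvg_comp gy ufl.
have [_ Flz] := clF _ l z (fun n => AD _ (uA _)) uhl vgz.
exists l => //; exists (fun n => f (g n + N)%N).
  by move=> m n; rewrite fincr; exact: etrans (leq_add2r _ _ _) (gincr m n).
by split; rewrite ?Flz.
Qed.

(** * Minimizers and stability *)

Section setting.
Variables (K : realType) (X Y : topologicalType) (D : set X) (F : X -> Y).
Variables (Rf : X -> \bar K) (S : Y -> Y -> \bar K).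
Hypothesis S_ge0 : forall z w, (0 <= S z w)%E.
Hypothesis closedF : seq_closed_map D F.
Hypothesis lscR : lower_semicontinuous Rf.
Hypothesis compactR : forall C : K, 0 < C -> seq_compact (Xad D Rf C).
Hypothesis compactS : forall (C : K) (w : Y), 0 < C ->
  seq_compact [set z | (F @` D) z /\ (S z w <= C%:E)%E].

Lemma Xad_le (r s : K) : r <= s -> Xad D Rf r `<=` Xad D Rf s.
Proof. by move=> rs x [Dx xr]; split=> //; apply: (le_trans xr); rewrite lee_fin. Qed.

(** The radius may be 0 whereas compactness is available for positive radii only:
one extracts in the set of radius r + 1, and lower semicontinuity of [Rf] brings
the limit back to radius r. *)
Lemma Xad_cvg_subseq (r C : K) (w : Y) (u : nat -> X) :
  0 <= r -> 0 < C -> (forall n, Xad D Rf r (u n)) ->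
  (\forall n \near \oo, (S (F (u n)) w <= C%:E)%E) ->
  exists2 l, Xad D Rf r l & exists2 f, increasing_seq f &
    (u \o f) @ \oo --> l /\ (F \o u \o f) @ \oo --> F l.
Proof.
move=> r0 C0 ur uC; have r1 : 0 < r + 1 by rewrite ltr_wpDl.
have [||l [Dl _] [f fincr [ufl Ful]]] :=
    closed_map_cvg_subseq closedF _ (compactR r1) (@compactS C w C0)
      (fun n => Xad_le (ler_wpDr ler01 (lexx r)) (ur n)).
- by move=> x [].
- by apply: filterS uC => n un; split=> //; exists (u n) => //; case: (ur n).
exists l; last by exists f.
split=> //; apply: (lower_semicontinuous_le lscR ufl).
by apply: nearW => n; case: (ur (f n)).
Qed.

(** The direct method: a minimizing sequence has bounded residuals, so it can be
extracted so that its images converge to the image of an element of the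
constraint set, and the residual is lower semicontinuous along them. *)
Lemma ivanov_minimizer_exists (r : K) (w : Y) :
  lower_semicontinuous (fun z => S z w) -> 0 <= r -> Xad D Rf r !=set0 ->
  exists x, ivanov_minimizers D F Rf S r w x.
Proof.
move=> lscS r0 [x0 x0r].
pose V := [set S (F x) w | x in Xad D Rf r].
have mV x : Xad D Rf r x -> (ereal_inf V <= S (F x) w)%E.
  by move=> xr; apply: ereal_inf_lbound; exists x.
(* When the infimum is infinite the residual is constant, so any point of the
   constraint set is a minimizer. *)
have [mfin|] := boolP (ereal_inf V \is a fin_num); last first.
  rewrite ge0_fin_numE; last by apply: le_ereal_inf_tmp => _ [x _ <-].
  rewrite -leNgt leye_eq => /eqP my; exists x0; split=> // x /mV.
  by rewrite my leye_eq => /eqP ->; rewrite leey.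
have {}mfin : ereal_inf V = (fine (ereal_inf V))%:E by rewrite fineK.
set m := fine _ in mfin.
have /choice[u uP] (n : nat) : exists x, Xad D Rf r x /\
    (S (F x) w <= (m + n.+1%:R^-1)%:E)%E.
  have [_ [x xr <-] xm] : exists2 v, V v & (v < ereal_inf V + n.+1%:R^-1%:E)%E.
    by apply: lb_ereal_inf_adherent; rewrite ?mfin ?invr_gt0.
  by exists x; split=> //; apply/ltW; rewrite EFinD -mfin.
have ur n : Xad D Rf r (u n) by case: (uP n).
have um (e : K) : 0 < e -> \forall n \near \oo, (S (F (u n)) w <= (m + e)%:E)%E.
  move=> e0; apply: filterS (near_infty_natSinv_lt (PosNum e0)) => n /= ne.
  by apply: le_trans (uP n).2 _; rewrite lee_fin lerD2l ltW.
have m0 : 0 <= m by rewrite -lee_fin -mfin; apply: le_ereal_inf_tmp => _ [x _ <-].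
have [l lr [f fincr [_ Ful]]] :=
  Xad_cvg_subseq r0 (ltr_wpDl m0 ltr01) ur (um 1 ltr01).
exists l; split=> // x /mV; apply: le_trans; rewrite mfin.
apply: (lower_semicontinuous_le_eps lscS Ful) => e e0.
exact: (increasing_seq_cvgny fincr (um e e0)).
Qed.

(** The convergence mechanism shared by all parameter choices: the bound on [Rf]
supplies compactness in [X], and the discrepancy bound identifies the limit as a
solution. *)
Lemma subseq_cvg_of_bounds (y : Y) (yd : K -> Y) (tau r : K) (xh : K -> X) :
  0 < tau -> 0 <= r -> lower_semicontinuous (fun z => S z y) ->
  S (yd delta) y @[delta --> 0^'+] --> (0%E : \bar K) ->
  (forall u v : nat -> Y,
     (fun n => S (u n) (v n)) @ \oo --> (0%E : \bar K) ->
     (fun n => S (v n) y) @ \oo --> (0%E : \bar K) ->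
     (fun n => S (u n) y) @ \oo --> (0%E : \bar K)) ->
  (forall z, S z y = 0%E -> z = y) ->
  (forall delta, 0 < delta -> Xad D Rf r (xh delta) /\
     (S (F (xh delta)) (yd delta) <= (tau * delta)%:E)%E) ->
  subseq_cvg_to_solution D F y xh.
Proof.
move=> tau0 r0 lscS yd0 condA condB xhP d d_gt0 d0.
have Sd : (fun n => S (F (xh (d n))) (yd (d n))) @ \oo --> (0%E : \bar K).
  apply: (@squeeze_cvge _ _ _ _ (cst 0%E) _ (fun n => (tau * d n)%:E)).
  - by apply: nearW => n; rewrite S_ge0; case: (xhP _ (d_gt0 n)).
  - exact: cvg_cst.
  - by apply: cvg_EFin; [exact: nearW | rewrite -(mulr0 tau); exact: cvgMr].
have ydd : (fun n => S (yd (d n)) y) @ \oo --> (0%E : \bar K).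
  apply: cvg_comp yd0 => P Pr.
  have dP : \forall n \near \oo, 0 < d n -> P (d n) := d0 _ Pr.
  by apply: filterS dP => n; apply.
have Sy := condA (F \o xh \o d) (yd \o d) Sd ydd.
have [l [Dl _] [f fincr [xl Fxl]]] := Xad_cvg_subseq r0 ltr01
  (fun n => (xhP _ (d_gt0 n)).1) (cvge0_le Sy ltr01).
exists l; last by exists f.
split=> //; apply/condB/le_anti; rewrite S_ge0 andbT.
apply: (lower_semicontinuous_le_eps lscS Fxl) => e e0; rewrite add0r.
exact: (increasing_seq_cvgny fincr (cvge0_le Sy e0)).
Qed.

(** The rules bound the residual of some minimizer; since all minimizers of one
Ivanov problem have the same residual, this carries the bound over to the given
family. The same statement serves to compare a minimizer with [xdag]. *)
Lemma ivanov_residual_le (r c : K) (w : Y) (x x' : X) :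
  ivanov_minimizers D F Rf S r w x -> Xad D Rf r x' ->
  (S (F x') w <= c%:E)%E -> (S (F x) w <= c%:E)%E.
Proof. by move=> [_ xmin] /xmin; exact: le_trans. Qed.

End setting.

(** * Convergence of the parameter choices *)

(* [hnoise_sym] makes explicit a smallness of the noise with respect to the
   second argument of S; it follows from [hnoise] when S is symmetric, and the
   conclusion fails without it. *)
Theorem corollary2p6 (K : realType) (X Y : topologicalType)
  (D : set X) (F : X -> Y) (Rf : X -> \bar K) (S : Y -> Y -> \bar K)
  (hR : forall x, (0 <= Rf x)%E) (hS : forall z w, (0 <= S z w)%E)
  (tau : K) (htau : 1 <= tau)
  (y : Y) (hy : (F @` D) y)
  (yd : K -> Y) (hyd0 : yd 0 = y)
  (hnoise : forall delta : K, 0 < delta -> (S y (yd delta) <= delta%:E)%E)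
  (hnoise_sym : S (yd delta) y @[delta --> 0^'+] --> (0%E : \bar K))
  (cond_i : seq_closed_map D F)
  (cond_ii_R : lower_semicontinuous Rf)
  (cond_ii_S : forall delta : K, 0 <= delta ->
     lower_semicontinuous (fun z => S z (yd delta)))
  (cond_iii : forall C : K, 0 < C -> seq_compact [set x | D x /\ (Rf x <= C%:E)%E])
  (cond_iv : forall (C : K) (w : Y), 0 < C ->
     seq_compact [set z | (F @` D) z /\ (S z w <= C%:E)%E])
  (xdag : X) (hxdag : Rminimizing_solutions D F Rf y xdag)
  (cond_v : (Rf xdag < +oo)%E)
  (cond_A : forall u v : nat -> Y,
     (fun n => S (u n) (v n)) @ \oo --> (0%E : \bar K) ->
     (fun n => S (v n) y) @ \oo --> (0%E : \bar K) ->
     (fun n => S (u n) y) @ \oo --> (0%E : \bar K))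
  (cond_B : forall z, S z y = 0%E -> z = y) :
  [/\ (forall xMo : K -> X,
         (forall delta, 0 < delta ->
            morozov_minimizers D F Rf S tau delta (yd delta) (xMo delta)) ->
         subseq_cvg_to_solution D F y xMo),
      (forall (rho : K) (xI : K -> X),
         ruleI Rf xdag rho ->
         (forall delta, 0 < delta ->
            ivanov_minimizers D F Rf S rho (yd delta) (xI delta)) ->
         subseq_cvg_to_solution D F y xI),
      (forall (rho : K -> K) (xII : K -> X),
         (forall delta, 0 < delta ->
            ruleII D F Rf S tau delta (yd delta) (rho delta)) ->
         (forall delta, 0 < delta ->
            ivanov_minimizers D F Rf S (rho delta) (yd delta) (xII delta)) ->
         subseq_cvg_to_solution D F y xII) &
      ((forall delta, 0 < delta ->
          condition_vi D F Rf S tau delta (yd delta)) ->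
       forall (rho : K -> K) (xIII : K -> X),
         (forall delta, 0 < delta ->
            ruleIII D F Rf S tau delta (yd delta) (rho delta)) ->
         (forall delta, 0 < delta ->
            ivanov_minimizers D F Rf S (rho delta) (yd delta) (xIII delta)) ->
         subseq_cvg_to_solution D F y xIII)].
Proof.
have [[Dxdag Fxdag] _] := hxdag.
pose r := fine (Rf xdag).
have rE : r%:E = Rf xdag by rewrite fineK// ge0_fin_numE.
have r0 : 0 <= r by rewrite -lee_fin rE.
have tau0 : 0 < tau := lt_le_trans ltr01 htau.
have xdag_r : Xad D Rf r xdag by split=> //; rewrite rE.
have delta_le (delta : K) : 0 < delta -> delta <= tau * delta.
  by move=> delta0; rewrite ler_peMl// ltW.
have dag_delta (delta : K) : 0 < delta -> (S (F xdag) (yd delta) <= delta%:E)%E.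
  by rewrite Fxdag; exact: hnoise.
have dag_tau (delta : K) : 0 < delta ->
    (S (F xdag) (yd delta) <= (tau * delta)%:E)%E.
  move=> delta0; apply: le_trans (dag_delta _ delta0) _.
  by rewrite lee_fin delta_le.
have lscSy : lower_semicontinuous (fun z => S z y).
  by rewrite -hyd0; exact: cond_ii_S.
have conv xh := @subseq_cvg_of_bounds _ _ _ D F Rf S hS cond_i cond_ii_R cond_iii
  cond_iv y yd tau r xh tau0 r0 lscSy hnoise_sym cond_A cond_B.
split.
- move=> xMo xMoP; apply: conv => delta delta0.
  have [[Dx Sx] xmin] := xMoP _ delta0.
  split=> //; split=> //; rewrite rE; apply: xmin; split=> //; exact: dag_tau.
- move=> rho xI; rewrite /ruleI -rE => -[->] xIP; apply: conv => delta delta0.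
  split; first by case: (xIP _ delta0).
  exact: ivanov_residual_le (xIP _ delta0) xdag_r (dag_tau _ delta0).
- move=> rho xII rhoP xIIP; apply: conv => delta delta0.
  have [[_ [x [xrho _] Sx]] rho_min] := rhoP _ delta0.
  have [xIIrho _] := xIIP _ delta0.
  split; last exact: ivanov_residual_le (xIIP _ delta0) xrho Sx.
  apply: Xad_le xIIrho; apply: rho_min; split=> //.
  have [x' x'min] := ivanov_minimizer_exists hS cond_i cond_ii_R cond_iii cond_iv
    (cond_ii_S _ (ltW delta0)) r0 (ex_intro _ _ xdag_r).
  by exists x' => //; exact: ivanov_residual_le x'min xdag_r (dag_tau _ delta0).
- move=> _ rho xIII rhoP xIIIP; apply: conv => delta delta0.
  have [_ [x xmin [delta_lt Sx]]] := rhoP _ delta0.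
  have [xIIIrho _] := xIIIP _ delta0.
  split; last by apply: ivanov_residual_le (xIIIP _ delta0) _ Sx; case: xmin.
  apply: Xad_le xIIIrho; rewrite leNgt; apply/negP => /ltW r_rho.
  have := ivanov_residual_le xmin (Xad_le r_rho xdag_r) (dag_delta _ delta0).
  by rewrite leNgt delta_lt.
Qed.
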